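(* Let $(A,P_A)$, $(B,P_B)$, $(C,P_C)$ be finite strict posets. Then $$\#\{f\in\mathrm{Mor}(P_A,P_B):(f(A),P_B\cap(f(A)\times f(A)))\cong(C,P_C)\}=\frac{|\mathrm{Epi}(P_A,P_C)|\cdot|\mathrm{RegMono}(P_C,P_B)|}{|\mathrm{Aut}(P_C)|},$$ and $$\#\{f\in\mathrm{Mor}(P_A,P_B):(f(A),\mathrm{Tr}(f(P_A)))\cong(C,P_C)\}=\frac{|\mathrm{RegEpi}(P_A,P_C)|\cdot|\mathrm{Mono}(P_C,P_B)|}{|\mathrm{Aut}(P_C)|}.$$
   Context: $\mathsf{PoSet}$ is the category whose objects are finite sets with a strict partial order (asymmetric, transitive relation) and whose morphisms are strictly order-preserving maps ($(a,a')\in P_A\Rightarrow(f(a),f(a'))\in P_B$). $\mathrm{Mor},\mathrm{Mono},\mathrm{Epi},\mathrm{Aut}$ denote morphisms, monomorphisms, epimorphisms, automorphisms in this category; $\mathrm{RegMono}$ regular monomorphisms (equalizers of some parallel pair), $\mathrm{RegEpi}$ regular epimorphisms (coequalizers of some parallel pair). $f(P_A)=\{(f(a),f(a')):(a,a')\in P_A\}$ and $\mathrm{Tr}$ denotes transitive closure. *)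

(* Defs.v *)
From Stdlib Require Import Relation_Operators.
From HB Require Import structures.
From mathcomp Require Import all_boot all_order all_algebra.
From mathcomp Require Import boolp.

Set Implicit Arguments.
Unset Strict Implicit.
Unset Printing Implicit Defensive.

Record sposet := SPoset {
  carrier :> finType;
  slt : rel carrier;
  slt_asym : forall x y, slt x y -> ~~ slt y x;
  slt_trans : transitive slt
}.

Definition strictly_monotone (A B : sposet) (f : {ffun A -> B}) : bool :=
  [forall x : A, forall y : A, slt x y ==> slt (f x) (f y)].

Record Mor (A B : sposet) := MkMor {
  mor_ffun :> {ffun A -> B};
  mor_monotone : strictly_monotone mor_ffun
}.

HB.instance Definition _ (A B : sposet) := [isSub for @mor_ffun A B].
HB.instance Definition _ (A B : sposet) := [Finite of Mor A B by <:].

Lemma morP (A B : sposet) (f : Mor A B) (x y : A) :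
  slt x y -> slt (f x) (f y).
Proof. by move: (mor_monotone f) => /forallP /(_ x) /forallP /(_ y) /implyP; apply. Qed.

Lemma idm_subproof (A : sposet) : @strictly_monotone A A [ffun x => x].
Proof. by apply/forallP=> x; apply/forallP=> y; rewrite !ffunE; apply/implyP. Qed.

Definition idm (A : sposet) : Mor A A := MkMor (idm_subproof A).

Lemma compm_subproof (A B C : sposet) (g : Mor B C) (f : Mor A B) :
  @strictly_monotone A C [ffun x => g (f x)].
Proof.
apply/forallP=> x; apply/forallP=> y; rewrite !ffunE; apply/implyP=> xy.
by apply: morP; apply: morP.
Qed.

Definition compm (A B C : sposet) (g : Mor B C) (f : Mor A B) : Mor A C :=
  MkMor (compm_subproof g f).

Definition is_iso (A B : sposet) (f : Mor A B) : Prop :=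
  exists g : Mor B A, compm g f = idm A /\ compm f g = idm B.

Definition isomorphic (A B : sposet) : Prop := exists f : Mor A B, is_iso f.

Definition is_mono (A B : sposet) (f : Mor A B) : Prop :=
  forall (X : sposet) (g h : Mor X A), compm f g = compm f h -> g = h.

Definition is_epi (A B : sposet) (f : Mor A B) : Prop :=
  forall (X : sposet) (g h : Mor B X), compm g f = compm h f -> g = h.

Definition is_equalizer (E A B : sposet) (e : Mor E A) (u v : Mor A B) : Prop :=
  compm u e = compm v e /\
  forall (X : sposet) (k : Mor X A), compm u k = compm v k ->
    exists! m : Mor X E, compm e m = k.

Definition is_coequalizer (A B Q : sposet) (q : Mor B Q) (u v : Mor A B) : Prop :=
  compm q u = compm q v /\
  forall (X : sposet) (k : Mor B X), compm k u = compm k v ->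
    exists! m : Mor Q X, compm m q = k.

Definition is_regmono (A B : sposet) (f : Mor A B) : Prop :=
  exists (D : sposet) (u v : Mor B D), is_equalizer f u v.

Definition is_regepi (A B : sposet) (f : Mor A B) : Prop :=
  exists (D : sposet) (u v : Mor D A), is_coequalizer f u v.

Definition Mono (A B : sposet) : {set Mor A B} := [set f | `[< is_mono f >]].
Definition Epi (A B : sposet) : {set Mor A B} := [set f | `[< is_epi f >]].
Definition RegMono (A B : sposet) : {set Mor A B} :=
  [set f | `[< is_regmono f >]].
Definition RegEpi (A B : sposet) : {set Mor A B} :=
  [set f | `[< is_regepi f >]].
Definition Aut (A : sposet) : {set Mor A A} := [set f | `[< is_iso f >]].

Section Images.
Variables (A B : sposet) (f : Mor A B).

Definition image_type : finType := {y : B | y \in codom f}.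

Definition induced_rel : rel image_type := fun y y' => slt (val y) (val y').

Lemma induced_asym (y y' : image_type) : induced_rel y y' -> ~~ induced_rel y' y.
Proof. exact: slt_asym. Qed.

Lemma induced_trans : transitive induced_rel.
Proof. by move=> y x z; apply: slt_trans. Qed.

Definition image_induced : sposet := SPoset induced_asym induced_trans.

(* The relation f(P_A), viewed on f(A). *)
Definition pushed_rel : rel image_type := fun y y' =>
  [exists a : A, exists a' : A, [&& slt a a', val y == f a & val y' == f a']].

Definition tr_pushed_rel : rel image_type := fun y y' =>
  `[< clos_trans image_type pushed_rel y y' >].

Lemma tr_pushed_slt (y y' : image_type) :
  tr_pushed_rel y y' -> slt (val y) (val y').
Proof.
move/asboolP; elim=> {y y'} [y y'|x y z _ xy _ yz]; last exact: slt_trans xy yz.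
by case/existsP=> a /existsP [a' /and3P [aa' /eqP-> /eqP->]]; apply: morP.
Qed.

Lemma tr_pushed_asym (y y' : image_type) :
  tr_pushed_rel y y' -> ~~ tr_pushed_rel y' y.
Proof.
by move/tr_pushed_slt/slt_asym; apply: contra => /tr_pushed_slt.
Qed.

Lemma tr_pushed_trans : transitive tr_pushed_rel.
Proof.
by move=> y x z /asboolP xy /asboolP yz; apply/asboolP; apply: t_trans xy yz.
Qed.

Definition image_generated : sposet := SPoset tr_pushed_asym tr_pushed_trans.

End Images.

(* Main.v *)
Require Import Defs.
From Stdlib Require Import Relation_Operators.
From mathcomp Require Import all_boot all_order all_algebra.
From mathcomp Require Import boolp.

(** Both identities are instances of one counting principle.  Suppose [E] and
    [M] are classes of morphisms, stable under isomorphisms, with [E] consisting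
    of epimorphisms, such that every [f] factors as [m o e] with [e] in [E] and
    [m] in [M] through an object [im f], and such that commuting squares
    [m o e = m' o e'] have diagonal fillers.  Then factorizations are unique up
    to a unique isomorphism, so composition maps [E(A,C) x M(C,B)] onto the
    morphisms [f] with [im f] isomorphic to [C], and each fibre is a torsor
    under [Aut C].

    The two systems are (epi, regular mono), through the image with the induced
    order, and (regular epi, mono), through the image with the generated order.
    The fillers come from the universal properties of equalizers and
    coequalizers. *)

Set Implicit Arguments.
Unset Strict Implicit.
Unset Printing Implicit Defensive.

Import GRing.Theory Num.Theory.

(** * Composition of morphisms *)

Lemma mor_ext (A B : sposet) (f g : Mor A B) : f =1 g -> f = g.
Proof. by move=> fg; apply/val_inj/ffunP. Qed.

Lemma compmE (A B C : sposet) (g : Mor B C) (f : Mor A B) x :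
  compm g f x = g (f x).
Proof. by rewrite ffunE. Qed.

Lemma idmE (A : sposet) x : idm A x = x.
Proof. by rewrite ffunE. Qed.

Lemma compmA (A B C D : sposet) (h : Mor C D) (g : Mor B C) (f : Mor A B) :
  compm h (compm g f) = compm (compm h g) f.
Proof. by apply: mor_ext => x; rewrite !compmE. Qed.

Lemma compm1 (A B : sposet) (f : Mor A B) : compm f (idm A) = f.
Proof. by apply: mor_ext => x; rewrite compmE idmE. Qed.

Lemma comp1m (A B : sposet) (f : Mor A B) : compm (idm B) f = f.
Proof. by apply: mor_ext => x; rewrite compmE idmE. Qed.

Definition mkmor (A B : sposet) (f : A -> B)
    (fM : forall x y, slt x y -> slt (f x) (f y)) : Mor A B.
Proof.
exists [ffun x => f x]; apply/forallP=> x; apply/forallP=> y.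
by rewrite !ffunE; apply/implyP/fM.
Defined.

Lemma mkmorE (A B : sposet) (f : A -> B) fM x : @mkmor A B f fM x = f x.
Proof. by rewrite ffunE. Qed.

Lemma is_iso_id (A : sposet) : is_iso (idm A).
Proof. by exists (idm A); rewrite compm1. Qed.

(** * Counting through a factorization system *)

Section FactorizationCount.

Variables E M : forall A B : sposet, Mor A B -> Prop.
Variable im : forall A B : sposet, Mor A B -> sposet.

Hypothesis E_epi : forall (A B : sposet) (e : Mor A B), E e -> is_epi e.
Hypothesis E_iso : forall (A B C : sposet) (s : Mor B C) (e : Mor A B),
  is_iso s -> E e -> E (compm s e).
Hypothesis M_iso : forall (A B C : sposet) (m : Mor B C) (s : Mor A B),
  is_iso s -> M m -> M (compm m s).
Hypothesis im_factor : forall (A B : sposet) (f : Mor A B),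
  exists (e : Mor A (im f)) (m : Mor (im f) B), [/\ E e, M m & compm m e = f].
Hypothesis EM_filler : forall (A B C C' : sposet) (e : Mor A C) (m : Mor C B)
    (e' : Mor A C') (m' : Mor C' B),
  E e -> M m' -> compm m e = compm m' e' ->
  exists s : Mor C C', compm s e = e' /\ compm m' s = m.

(** The filler exists in both directions. Each round trip fixes [e] or [e'], so cancelling these
    epimorphisms makes the two fillers mutually inverse. *)
Lemma factorization_unique (A B C C' : sposet) (e : Mor A C) (m : Mor C B)
    (e' : Mor A C') (m' : Mor C' B) :
  E e -> M m -> E e' -> M m' -> compm m e = compm m' e' ->
  exists s : Mor C C', is_iso s /\ compm s e = e'.
Proof.
move=> Ee Mm Ee' Mm' eq_f.
have [s [se _]] := EM_filler Ee Mm' eq_f.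
have [t [te _]] := EM_filler Ee' Mm (esym eq_f).
exists s; split=> //; exists t.
by split; [apply: (E_epi Ee)|apply: (E_epi Ee')];
  rewrite -compmA ?se ?te comp1m ?se ?te.
Qed.

Lemma isomorphic_im (A B C : sposet) (f : Mor A B) :
  isomorphic (im f) C <->
  exists (e : Mor A C) (m : Mor C B), [/\ E e, M m & compm m e = f].
Proof.
have [e [m [Ee Mm mef]]] := im_factor f; split.
  case=> s [t [ts st]]; exists (compm s e), (compm m t); split.
  - by apply: E_iso => //; exists t.
  - by apply: M_iso => //; exists s.
  - by rewrite -compmA [compm t _]compmA ts comp1m.
case=> e' [m' [Ee' Mm' mef']].
have [s [iso_s _]] := factorization_unique Ee Mm Ee' Mm' (etrans mef (esym mef')).
by exists s.
Qed.

(** The torsor statement: with [(e, m)] as base point, every factorization of the same morphism is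
    [(s e, m s^-1)] for exactly one automorphism [s]. *)
Lemma card_factorizations (A B C : sposet) (e : Mor A C) (m : Mor C B) :
  E e -> M m ->
  #|[set p : Mor A C * Mor C B |
      [&& `[< E p.1 >], `[< M p.2 >] & compm p.2 p.1 == compm m e]]|
  = #|Aut C|.
Proof.
move=> Ee Mm; set F := [set p | _].
(* The first component is epi, hence determines the second; it suffices to count first components,
   which form the orbit of [e] under [Aut C]. *)
have fst_inj : {in F &, injective fst}.
  move=> [e1 m1] [e2 m2]; rewrite !inE /= => /and3P[/asboolP Ee1 _ /eqP m1e].
  move=> /and3P[_ _ /eqP m2e] e12; rewrite -e12 in m2e *.
  by congr pair; apply: (E_epi Ee1); rewrite m1e m2e.
rewrite -(card_in_imset fst_inj).
have act_inj : injective (fun s : Mor C C => compm s e).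
  by move=> s t; apply: (E_epi Ee).
rewrite -(card_imset (mem (Aut C)) act_inj); apply: eq_card => e'.
apply/imsetP/imsetP => [[[e1 m1]]|[s]].
  rewrite inE /= => /and3P[/asboolP Ee1 /asboolP Mm1 /eqP m1e] ->.
  have [s [iso_s <-]] := factorization_unique Ee Mm Ee1 Mm1 (esym m1e).
  by exists s; rewrite // inE; apply/asboolP.
rewrite inE => /asboolP iso_s ->.
have [t [ts st]] := iso_s.
exists (compm s e, compm m t) => //; rewrite inE /=; apply/and3P; split.
- exact/asboolP/E_iso.
- by apply/asboolP/M_iso => //; exists s.
- by rewrite -compmA [compm t _]compmA ts comp1m.
Qed.

Lemma card_isomorphic_im (A B C : sposet) :
  (#|[set f : Mor A B | `[< isomorphic (im f) C >]]| * #|Aut C| =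
   #|[set e : Mor A C | `[< E e >]]| * #|[set m : Mor C B | `[< M m >]]|)%N.
Proof.
rewrite -[RHS]cardsX -[RHS]sum1_card.
(* Sort the pairs by their composite; every fibre then has [#|Aut C|] elements. *)
rewrite (partition_big (fun p => compm p.2 p.1)
  (mem [set f : Mor A B | `[< isomorphic (im f) C >]])) /=; last first.
  move=> [e m]; rewrite !inE /= => /andP[/asboolP Ee /asboolP Mm].
  by apply/asboolP/isomorphic_im; exists e, m.
rewrite -sum_nat_const; apply: eq_bigr => f.
rewrite inE => /asboolP/isomorphic_im [e [m [Ee Mm <-]]].
rewrite -(card_factorizations Ee Mm) sum1_card.
by apply: eq_card => p; rewrite [RHS]unfold_in !inE andbA.
Qed.

Lemma card_isomorphic_im_rat (A B C : sposet) :
  (#|[set f : Mor A B | `[< isomorphic (im f) C >]]|%:R =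
   #|[set e : Mor A C | `[< E e >]]|%:R * #|[set m : Mor C B | `[< M m >]]|%:R
   / #|Aut C|%:R :> rat)%R.
Proof.
rewrite -natrM -card_isomorphic_im natrM mulfK // pnatr_eq0 -lt0n.
by apply/card_gt0P; exists (idm C); rewrite inE; apply/asboolP/is_iso_id.
Qed.

End FactorizationCount.

(** * Classes of morphisms *)

Lemma surj_epi (A B : sposet) (f : Mor A B) :
  (forall y, exists x, f x = y) -> is_epi f.
Proof.
move=> f_surj X g h gh; apply: mor_ext => y; have [x <-] := f_surj y.
by rewrite -!compmE gh.
Qed.

Lemma inj_mono (A B : sposet) (f : Mor A B) : injective f -> is_mono f.
Proof.
move=> f_inj X g h gh; apply: mor_ext => x.
by apply: f_inj; rewrite -!compmE gh.
Qed.

Lemma epi_iso (A B C : sposet) (s : Mor B C) (e : Mor A B) :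
  is_iso s -> is_epi e -> is_epi (compm s e).
Proof.
move=> [t [_ st]] epi_e X g h; rewrite !compmA => /epi_e gh.
by rewrite -[g]compm1 -[h]compm1 -st !compmA gh.
Qed.

Lemma mono_iso (A B C : sposet) (m : Mor B C) (s : Mor A B) :
  is_iso s -> is_mono m -> is_mono (compm m s).
Proof.
move=> [t [ts _]] mono_m X g h; rewrite -!compmA => /mono_m gh.
by rewrite -[g]comp1m -[h]comp1m -ts -!compmA gh.
Qed.

Lemma regmono_iso (A B C : sposet) (m : Mor B C) (s : Mor A B) :
  is_iso s -> is_regmono m -> is_regmono (compm m s).
Proof.
move=> [t [ts st]] [D [u [v [eq_uv univ]]]]; exists D, u, v; split.
  by rewrite !compmA eq_uv.
move=> X k /univ [n [mn uniq_n]]; exists (compm t n); split.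
  by rewrite -compmA [compm s _]compmA st comp1m.
by move=> n'; rewrite -compmA => /uniq_n ->; rewrite compmA ts comp1m.
Qed.

Lemma regepi_iso (A B C : sposet) (s : Mor B C) (e : Mor A B) :
  is_iso s -> is_regepi e -> is_regepi (compm s e).
Proof.
move=> [t [ts st]] [D [u [v [eq_uv univ]]]]; exists D, u, v; split.
  by rewrite -!compmA eq_uv.
move=> X k /univ [n [ne uniq_n]]; exists (compm n t); split.
  by rewrite -compmA [compm t _]compmA ts comp1m.
by move=> n'; rewrite compmA => /uniq_n ->; rewrite -compmA st compm1.
Qed.

(** If [g e = h e], then [g] and [h] both factor this one morphism through the coequalizer [e], and
    such a factorization is unique. *)
Lemma regepi_epi (A B : sposet) (e : Mor A B) : is_regepi e -> is_epi e.
Proof.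
move=> [D [u [v [eq_uv univ]]]] X g h gh.
have /univ [n [_ uniq_n]] : compm (compm h e) u = compm (compm h e) v.
  by rewrite -!compmA eq_uv.
by rewrite -(uniq_n g gh) -(uniq_n h erefl).
Qed.

Lemma regmono_mono (A B : sposet) (m : Mor A B) : is_regmono m -> is_mono m.
Proof.
move=> [D [u [v [eq_uv univ]]]] X g h gh.
have /univ [n [_ uniq_n]] : compm u (compm m h) = compm v (compm m h).
  by rewrite !compmA eq_uv.
by rewrite -(uniq_n g gh) -(uniq_n h erefl).
Qed.

(** Cancelling [e] shows that [m] equalizes the pair defining [m'], so [m] factors through [m']. The
    other triangle commutes after composing with the mono [m']. *)
Lemma epi_regmono_filler (A B C C' : sposet) (e : Mor A C) (m : Mor C B)
    (e' : Mor A C') (m' : Mor C' B) :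
  is_epi e -> is_regmono m' -> compm m e = compm m' e' ->
  exists s : Mor C C', compm s e = e' /\ compm m' s = m.
Proof.
move=> epi_e rm_m' sq; have mono_m' := regmono_mono rm_m'.
have [D [u [v [eq_uv univ]]]] := rm_m'.
have [|s [m's _]] := univ _ m.
  by apply: epi_e; rewrite -!compmA sq !compmA eq_uv.
by exists s; split=> //; apply: mono_m'; rewrite compmA m's.
Qed.

Lemma regepi_mono_filler (A B C C' : sposet) (e : Mor A C) (m : Mor C B)
    (e' : Mor A C') (m' : Mor C' B) :
  is_regepi e -> is_mono m' -> compm m e = compm m' e' ->
  exists s : Mor C C', compm s e = e' /\ compm m' s = m.
Proof.
move=> re_e mono_m' sq; have epi_e := regepi_epi re_e.
have [D [u [v [eq_uv univ]]]] := re_e.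
have [|s [se _]] := univ _ e'.
  by apply: mono_m'; rewrite !compmA -sq -!compmA eq_uv.
by exists s; split=> //; apply: epi_e; rewrite -compmA se.
Qed.

Section DoubledPoset.

Variable B : sposet.

(** The order ignores the tag: the two copies of a point are incomparable, and tagging by an
    arbitrary predicate is monotone. *)
Definition double_rel : rel (B * bool)%type := fun p q => slt p.1 q.1.

Lemma double_asym p q : double_rel p q -> ~~ double_rel q p.
Proof. exact: slt_asym. Qed.

Lemma double_trans : transitive double_rel.
Proof. by move=> q p r; apply: slt_trans. Qed.

Definition double : sposet := SPoset double_asym double_trans.

Definition double_tag (P : pred B) : Mor B double :=
  @mkmor B double (fun b => (b, P b)) (fun _ _ xy => xy).

End DoubledPoset.

(* An embedding equalizes the untagged copy of [B] and the copy whose points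
   outside the image are tagged. *)
Lemma embedding_regmono (A B : sposet) (f : Mor A B) :
  injective f -> (forall x y, slt (f x) (f y) -> slt x y) -> is_regmono f.
Proof.
move=> f_inj f_refl.
exists (double B), (double_tag pred0), (double_tag (fun b => b \notin codom f)).
split; first by apply: mor_ext => x; rewrite !compmE !mkmorE codom_f.
move=> X k eq_k.
(* Comparing tags at [k x]: one side is [false], so the other, [k x \notin codom f], is too. *)
have k_im x : k x \in codom f.
  move/(congr1 (fun g : Mor X (double B) => g x)): eq_k.
  by rewrite !compmE !mkmorE => -[/esym/negbFE].
have nM x y : slt x y -> slt (iinv (k_im x)) (iinv (k_im y)).
  by move=> xy; apply: f_refl; rewrite !f_iinv; apply: morP.
exists (mkmor nM); split.
  by apply: mor_ext => x; rewrite compmE mkmorE f_iinv.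
by move=> n fn; apply: (inj_mono f_inj); rewrite fn; apply: mor_ext => x;
  rewrite compmE mkmorE f_iinv.
Qed.

Section KernelPair.

Variables (A B : sposet) (f : Mor A B).

Definition kernel_type : finType := {p : A * A | f p.1 == f p.2}.

Lemma kernel_asym (p q : kernel_type) : false -> ~~ false.
Proof. by []. Qed.

Lemma kernel_trans : transitive (fun _ _ : kernel_type => false).
Proof. by []. Qed.

(* The discrete order makes both projections strictly monotone. *)
Definition kernel_pair : sposet := SPoset kernel_asym kernel_trans.

Definition kernel_fst : Mor kernel_pair A.
Proof. by apply: (@mkmor kernel_pair A (fun p => (val p).1)). Defined.

Definition kernel_snd : Mor kernel_pair A.
Proof. by apply: (@mkmor kernel_pair A (fun p => (val p).2)). Defined.

End KernelPair.

(** A morphism constant on the fibres of [f] descends to a function on [B]. It is monotone on the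
    pairs coming from [A], and transitivity carries this to the order they generate. *)
Lemma generated_surj_regepi (A B : sposet) (f : Mor A B) :
  (forall y, exists x, f x = y) ->
  (forall y y', slt y y' ->
     clos_trans B (fun z z' => exists a a', [/\ slt a a', f a = z & f a' = z'])
       y y') ->
  is_regepi f.
Proof.
move=> f_surj f_gen; exists (kernel_pair f), (kernel_fst f), (kernel_snd f).
split; first by apply: mor_ext => p; rewrite !compmE !mkmorE; apply/eqP/(valP p).
move=> X k eq_k.
have k_ker a a' : f a = f a' -> k a = k a'.
  move/eqP=> faa'; pose p : kernel_pair f := exist _ (a, a') faa'.
  move/(congr1 (fun g : Mor (kernel_pair f) X => g p)): eq_k.
  by rewrite !compmE !mkmorE.
have f_im y : y \in codom f by have [x <-] := f_surj y; apply: codom_f.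
(* [iinv] picks some preimage; the choice is harmless because [k] is constant on fibres. *)
have nE a : k (iinv (f_im (f a))) = k a by apply: k_ker; rewrite f_iinv.
have nM y y' : slt y y' -> slt (k (iinv (f_im y))) (k (iinv (f_im y'))).
  move/f_gen; elim=> {y y'} [_ _ [a [a' [aa' <- <-]]]|x y z _ xy _ yz].
    by rewrite !nE; apply: morP.
  exact: slt_trans xy yz.
have nf : compm (mkmor nM) f = k by apply: mor_ext => a; rewrite compmE mkmorE nE.
exists (mkmor nM); split=> // n' n'f.
by apply: (surj_epi f_surj); rewrite nf.
Qed.

(** * The two image factorizations *)

Section ImageFactorizations.

Variables (A B : sposet) (f : Mor A B).

Definition corestr (x : A) : image_type f := exist _ (f x) (codom_f f x).

Lemma corestr_surj (y : image_type f) : exists x, corestr x = y.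
Proof.
by case: y => y y_im; exists (iinv y_im); apply: val_inj; rewrite /= f_iinv.
Qed.

Lemma corestr_pushed x x' : slt x x' -> pushed_rel (corestr x) (corestr x').
Proof.
by move=> xx'; apply/existsP; exists x; apply/existsP; exists x'; rewrite xx' !eqxx.
Qed.

Lemma image_induced_factor :
  exists (e : Mor A (image_induced f)) (m : Mor (image_induced f) B),
    [/\ is_epi e, is_regmono m & compm m e = f].
Proof.
have eM x y : slt x y -> @slt (image_induced f) (corestr x) (corestr y).
  exact: morP.
have mM (y y' : image_induced f) : slt y y' -> slt (val y) (val y') by [].
exists (mkmor eM), (mkmor mM); split.
- apply: surj_epi => y; have [x <-] := corestr_surj y.
  by exists x; rewrite mkmorE.
- apply: embedding_regmono => y y'; rewrite !mkmorE //; exact: val_inj.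
- by apply: mor_ext => x; rewrite compmE !mkmorE.
Qed.

Lemma image_generated_factor :
  exists (e : Mor A (image_generated f)) (m : Mor (image_generated f) B),
    [/\ is_regepi e, is_mono m & compm m e = f].
Proof.
have eM x y : slt x y -> @slt (image_generated f) (corestr x) (corestr y).
  by move=> xy; apply/asboolP/t_step/corestr_pushed.
have mM (y y' : image_generated f) : slt y y' -> slt (val y) (val y').
  exact: tr_pushed_slt.
exists (mkmor eM), (mkmor mM); split.
- apply: generated_surj_regepi => [y|y y' /asboolP].
    by have [x <-] := corestr_surj y; exists x; rewrite mkmorE.
  elim=> {y y'} [y y'|x y z _ xy _ yz]; last exact: t_trans xy yz.
  case/existsP=> a /existsP [a' /and3P [aa' /eqP ya /eqP y'a']].
  apply: t_step; exists a, a'; rewrite !mkmorE.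
  by split=> //; apply: val_inj.
- by apply: inj_mono => y y'; rewrite !mkmorE; apply: val_inj.
- by apply: mor_ext => x; rewrite compmE !mkmorE.
Qed.

End ImageFactorizations.

Local Open Scope ring_scope.

Theorem theoremA30 (A B C : sposet) :
  #|[set f : Mor A B | `[< isomorphic (image_induced f) C >]]|%:R
    = #|Epi A C|%:R * #|RegMono C B|%:R / #|Aut C|%:R :> rat
  /\
  #|[set f : Mor A B | `[< isomorphic (image_generated f) C >]]|%:R
    = #|RegEpi A C|%:R * #|Mono C B|%:R / #|Aut C|%:R :> rat.
Proof.
split.
(* Here the first class is that of all epimorphisms, so [E_epi] is the identity implication. *)
- exact: (card_isomorphic_im_rat (fun _ _ _ => id) epi_iso regmono_iso
    image_induced_factor epi_regmono_filler).
- exact: (card_isomorphic_im_rat regepi_epi regepi_iso mono_iso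
    image_generated_factor regepi_mono_filler).
Qed.
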